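(* Let $B$ be a unital $C^*$-algebra and suppose that $\pi:C^*(G,P)\to B$ is a unital homomorphism. Then $U:=\pi(T_b)$ and $V:=\pi(T_a)$ are isometries, and satisfy \begin{enumerate} \item[(a)] $VU^c=U^dV$; \item[(b)] $U^*V=U^{d-1}VU^{*c}$; \item[(c)] $V^*U^jV=0$ for $1\leq j<d$. \end{enumerate} Conversely, if $U$ and $V$ are isometries in a unital $C^*$-algebra $B$ satisfying (a), (b) and (c), then there is a Nica-covariant representation $S:P\to B$ such that $S_a=V$ and $S_b=U$, and a homomorphism $\pi_{U,V}:C^*(G,P)\to B$ such that $U=\pi_{U,V}(T_b)$ and $V=\pi_{U,V}(T_a)$.
   Context: Fix positive integers $c,d$. $G=\mathrm{BS}(c,d)=\langle a,b: ab^c=b^da\rangle$ is the Baumslag-Solitar group and $P$ is the submonoid of $G$ generated by $a$ and $b$. Order: for $g,h\in G$, $g\leq h$ means $g^{-1}h\in P$. It is known (Spielberg) that $(G,P)$ is quasi-lattice ordered: $P\cap P^{-1}=\{e\}$, and every pair $g,h\in G$ with a common upper bound in $P$ has a least upper bound $g\vee h$ in $P$. Write $g\vee h<\infty$ if a common upper bound in $P$ exists and $g\vee h=\infty$ otherwise. A Nica-covariant representation of $P$ is a map $x\mapsto S_x$ of $P$ into the isometries of a unital $C^*$-algebra with $S_e=1$, $S_xS_y=S_{xy}$, and $S_xS_x^*S_yS_y^*=S_{x\vee y}S_{x\vee y}^*$ if $x\vee y<\infty$ and $=0$ if $x\vee y=\infty$. $C^*(G,P)$ is the $C^*$-algebra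 generated by a universal Nica-covariant representation $T:P\to C^*(G,P)$. Homomorphisms of $C^*$-algebras are $*$-homomorphisms. *)

(* Defs.v *)
From HB Require Import structures.
From mathcomp Require Import all_boot all_order all_algebra.
From mathcomp Require Import complex.
From mathcomp Require Import all_classical all_reals all_analysis.

Set Implicit Arguments.
Unset Strict Implicit.
Unset Printing Implicit Defensive.

Import Order.TTheory GRing.Theory Num.Theory.
Import numFieldNormedType.Exports.

Local Open Scope classical_set_scope.
Local Open Scope ring_scope.

(* Unital C*-algebras over the complex numbers R[i], the zero algebra included.
   Hierarchy Builder accepts no structure below both CompleteNormedModule and
   PzRing, since NumDomain already inherits from a norm and a ring; the mixin
   therefore carries the product, and the pzRingType instance is derived from
   it. *)
HB.mixin Record isCStarAlgebra (R : realType) A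
    of CompleteNormedModule R[i] A := {
  cs_one : A;
  cs_mul : A -> A -> A;
  star : A -> A;
  cs_mulA : associative cs_mul;
  cs_mul1 : left_id cs_one cs_mul;
  cs_mulr1 : right_id cs_one cs_mul;
  cs_mulDl : left_distributive cs_mul +%R;
  cs_mulDr : right_distributive cs_mul +%R;
  cs_scaleAl : forall (k : R[i]) (x y : A),
    k *: cs_mul x y = cs_mul (k *: x) y;
  cs_scaleAr : forall (k : R[i]) (x y : A),
    k *: cs_mul x y = cs_mul x (k *: y);
  starK : involutive star;
  starD : {morph star : x y / x + y};
  starZ : forall (k : R[i]) (x : A), star (k *: x) = Num.conj k *: star x;
  cs_starM : forall x y : A, star (cs_mul x y) = cs_mul (star y) (star x);
  cs_norm_mul_le : forall x y : A, `|cs_mul x y| <= `|x| * `|y|;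
  cs_identity : forall x : A, `|cs_mul (star x) x| = `|x| ^+ 2
}.

#[short(type="cstarAlgType")]
HB.structure Definition CStarAlgebra (R : realType) :=
  {A of CompleteNormedModule R[i] A & isCStarAlgebra R A}.

HB.instance Definition _ (R : realType) (A : cstarAlgType R) :=
  GRing.Zmodule_isPzRing.Build (CStarAlgebra.sort A)
    (@cs_mulA R A) (@cs_mul1 R A) (@cs_mulr1 R A)
    (@cs_mulDl R A) (@cs_mulDr R A).

Section CStarTheory.
Variables (R : realType) (A : cstarAlgType R).
Implicit Types (k : R[i]) (x y : A).

Lemma scaleAl k x y : k *: (x * y) = (k *: x) * y.
Proof. exact: cs_scaleAl. Qed.

Lemma scaleAr k x y : k *: (x * y) = x * (k *: y).
Proof. exact: cs_scaleAr. Qed.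

Lemma starM x y : star (x * y) = star y * star x.
Proof. exact: cs_starM. Qed.

Lemma norm_mul_le x y : `|x * y| <= `|x| * `|y|.
Proof. exact: cs_norm_mul_le. Qed.

Lemma cstar_identity x : `|star x * x| = `|x| ^+ 2.
Proof. exact: cs_identity. Qed.

End CStarTheory.

Section CStar.
Variable R : realType.
Implicit Types A B : cstarAlgType R.

Definition cs_isometry A (v : A) : Prop := star v * v = 1.

(* Unitality is not part of the definition. *)
Definition star_hom A B (f : A -> B) : Prop :=
  [/\ linear f, {morph f : x y / x * y} & {morph f : x / star x}].

Definition cstar_subalgebra A (D : set A) : Prop :=
  [/\ closed D, D 0,
      forall (k : R[i]) x y, D x -> D y -> D (k *: x + y),
      forall x y, D x -> D y -> D (x * y)
    & forall x, D x -> D (star x)].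

Definition cstar_generated A (X : set A) : set A :=
  smallest (@cstar_subalgebra A) X.

End CStar.

(* The group < X | r > as a quotient of words in X and formal inverses:
   (x, false) stands for x and (x, true) for its inverse. *)
Section Presentation.
Variables (X : choiceType) (r : rel (seq (X * bool))).

Let word := seq (X * bool).

Inductive pres_eq : word -> word -> Prop :=
| pres_refl u : pres_eq u u
| pres_sym u v : pres_eq u v -> pres_eq v u
| pres_trans v u w : pres_eq u v -> pres_eq v w -> pres_eq u w
| pres_cat u u' v v' : pres_eq u u' -> pres_eq v v' ->
    pres_eq (u ++ v) (u' ++ v')
| pres_cancel x s : pres_eq [:: (x, s); (x, ~~ s)] [::]
| pres_rel u v : r u v -> pres_eq u v.

Definition pres_eqb (u v : word) : bool := `[< pres_eq u v >].

Lemma pres_eqb_equiv : equiv_class_of pres_eqb.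
Proof.
split=> [u|u v|v u w].
- by apply/asboolP; apply: pres_refl.
- by apply/asboolP/asboolP; apply: pres_sym.
- by move=> /asboolP uv /asboolP vw; apply/asboolP; apply: pres_trans uv vw.
Qed.

Definition pres_equiv : equiv_rel word := EquivRelPack pres_eqb_equiv.

Definition presented : Type := {eq_quot pres_equiv}%qT.

HB.instance Definition _ := Choice.on presented.
HB.instance Definition _ : EqQuotient word pres_equiv presented :=
  EqQuotient.on presented.

Local Notation pi := (\pi_presented)%qT.

Lemma pres_piP u v : pi u = pi v <-> pres_eq u v.
Proof.
split; first by move=> /eqquotP /asboolP.
by move=> uv; apply/eqquotP/asboolP.
Qed.

Lemma pres_repr u : pres_eq (repr (pi u)) u.
Proof. by apply/pres_piP; rewrite reprK. Qed.

Definition inv_word (u : word) : word := rev [seq (x.1, ~~ x.2) | x <- u].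

Lemma inv_word_cat u v : inv_word (u ++ v) = inv_word v ++ inv_word u.
Proof. by rewrite /inv_word map_cat rev_cat. Qed.

Lemma inv_wordK : involutive inv_word.
Proof.
move=> u; rewrite /inv_word map_rev revK -map_comp -[RHS]map_id.
by apply: eq_map => -[x s] /=; rewrite negbK.
Qed.

Lemma pres_mulV u : pres_eq (u ++ inv_word u) [::].
Proof.
elim: u => [|[x s] u IH]; first exact: pres_refl.
rewrite -cat1s inv_word_cat -!catA.
apply: (pres_trans (v := [:: (x, s)] ++ [::] ++ inv_word [:: (x, s)])).
  apply: pres_cat; first exact: pres_refl.
  by rewrite catA; apply: pres_cat; [exact: IH | exact: pres_refl].
exact: pres_cancel.
Qed.

Lemma pres_inv u v : pres_eq u v -> pres_eq (inv_word u) (inv_word v).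
Proof.
move=> uv; apply: (pres_trans (v := inv_word u ++ (v ++ inv_word v))).
  rewrite -[X in pres_eq X _]cats0; apply: pres_cat; first exact: pres_refl.
  exact/pres_sym/pres_mulV.
rewrite catA -[X in pres_eq _ X]cat0s.
apply: pres_cat; last exact: pres_refl.
apply: (pres_trans (v := inv_word u ++ u)).
  by apply: pres_cat; [exact: pres_refl | exact: pres_sym].
by rewrite -[X in _ ++ X]inv_wordK; exact: pres_mulV.
Qed.

Definition pres_one : presented := pi [::].
Definition pres_mul (x y : presented) : presented := pi (repr x ++ repr y).
Definition pres_invg (x : presented) : presented := pi (inv_word (repr x)).

Lemma pres_mulE u v : pres_mul (pi u) (pi v) = pi (u ++ v).
Proof. by apply/pres_piP; apply: pres_cat; exact: pres_repr. Qed.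

Lemma pres_invgE u : pres_invg (pi u) = pi (inv_word u).
Proof. by apply/pres_piP/pres_inv/pres_repr. Qed.

Lemma pres_mulA : associative pres_mul.
Proof.
elim/quotW=> u; elim/quotW=> v; elim/quotW=> w.
rewrite (pres_mulE v w) (pres_mulE u v) (pres_mulE u (v ++ w)).
by rewrite (pres_mulE (u ++ v) w) catA.
Qed.

Lemma pres_mul1 : left_id pres_one pres_mul.
Proof. by elim/quotW=> u; rewrite (pres_mulE [::] u). Qed.

Lemma pres_mulr1 : right_id pres_one pres_mul.
Proof. by elim/quotW=> u; rewrite (pres_mulE u [::]) cats0. Qed.

Lemma pres_mulrV : right_inverse pres_one pres_invg pres_mul.
Proof.
elim/quotW=> u; rewrite (pres_invgE u) (pres_mulE u (inv_word u)).
exact/pres_piP/pres_mulV.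
Qed.

Lemma pres_mulVr : left_inverse pres_one pres_invg pres_mul.
Proof.
elim/quotW=> u; rewrite (pres_invgE u) (pres_mulE (inv_word u) u).
by apply/pres_piP; rewrite -[X in _ ++ X]inv_wordK; exact: pres_mulV.
Qed.

HB.instance Definition _ := isGroup.Build presented
  pres_mulA pres_mul1 pres_mulr1 pres_mulVr pres_mulrV.

Definition pres_gen (x : X) : presented := pi [:: (x, false)].

End Presentation.

Inductive bsgen := GenA | GenB.

Definition bool_of_bsgen (x : bsgen) := if x is GenA then true else false.
Definition bsgen_of_bool (b : bool) := if b then GenA else GenB.
Lemma bsgenK : cancel bool_of_bsgen bsgen_of_bool. Proof. by case. Qed.
HB.instance Definition _ := Choice.copy bsgen (can_type bsgenK).

Section BaumslagSolitar.
Variables c d : nat.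

(* The single relation a b^c = b^d a. *)
Definition bs_rel : rel (seq (bsgen * bool)) := fun u v =>
  (u == (GenA, false) :: nseq c (GenB, false)) &&
  (v == rcons (nseq d (GenB, false)) (GenA, false)).

Definition BS := presented bs_rel.
HB.instance Definition _ := Group.on BS.

Definition bsa : BS := pres_gen bs_rel GenA.
Definition bsb : BS := pres_gen bs_rel GenB.

Inductive bs_pos : BS -> Prop :=
| bs_pos1 : bs_pos 1%g
| bs_posa : bs_pos bsa
| bs_posb : bs_pos bsb
| bs_posM x y : bs_pos x -> bs_pos y -> bs_pos (x * y)%g.

Definition BSpos : {pred BS} := fun x => `[< bs_pos x >].

Lemma BSpos_closed : umagma_closed BSpos.
Proof.
split; first by apply/asboolP; exact: bs_pos1.
by move=> x y /asboolP px /asboolP py; apply/asboolP; exact: bs_posM.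
Qed.

HB.instance Definition _ := isMulClosed.Build BS BSpos BSpos_closed.2.
HB.instance Definition _ := isMul1Closed.Build BS BSpos BSpos_closed.1.

(* The submonoid P, as a monoid whose elements are pairs of an element of BS
   and a proof of membership; val is the inclusion into BS. *)
Definition BSP := {x : BS | x \in BSpos}.
HB.instance Definition _ := SubChoice.on BSP.
HB.instance Definition _ :=
  SubChoice_isSubMonoid.Build BS (fun x => x \in BSpos) BSP BSpos_closed.

Lemma bsa_pos : bsa \in BSpos. Proof. by apply/asboolP; exact: bs_posa. Qed.
Lemma bsb_pos : bsb \in BSpos. Proof. by apply/asboolP; exact: bs_posb. Qed.

Definition bspa : BSP := exist _ bsa bsa_pos.
Definition bspb : BSP := exist _ bsb bsb_pos.

Definition bs_le (g h : BS) : Prop := (g^-1 * h)%g \in BSpos.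

Definition bs_upper_bound (g h : BS) (z : BSP) : Prop :=
  bs_le g (val z) /\ bs_le h (val z).

(* z is the join of g and h in P (unique, since bs_le is antisymmetric). *)
Definition bs_is_join (g h : BS) (z : BSP) : Prop :=
  bs_upper_bound g h z /\
  forall w : BSP, bs_upper_bound g h w -> bs_le (val z) (val w).

Section Nica.
Variable R : realType.

(* The last two fields are the two cases of Nica covariance: the join of x and y
   is finite, resp. infinite. *)
Record nica_rep (B : cstarAlgType R) (S : BSP -> B) : Prop := {
  nica_isometry : forall x, cs_isometry (S x);
  nica_one : S 1%g = 1;
  nica_mul : forall x y, S x * S y = S (x * y)%g;
  nica_join : forall x y z, bs_is_join (val x) (val y) z ->
    S x * star (S x) * (S y * star (S y)) = S z * star (S z);
  nica_orth : forall x y,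
    ~ (exists z, bs_upper_bound (val x) (val y) z) ->
    S x * star (S x) * (S y * star (S y)) = 0
}.

(* C*(G,P) is any C*-algebra A with a map T satisfying this predicate; the pair
   (A, T) is unique up to isomorphism. *)
Record universal_nica (A : cstarAlgType R) (T : BSP -> A) : Prop := {
  universal_nica_rep : nica_rep T;
  universal_nica_generated : cstar_generated (range T) = setT;
  universal_nica_lift : forall (B : cstarAlgType R) (S : BSP -> B),
    nica_rep S ->
    exists pi : A -> B, star_hom pi /\ forall x, pi (T x) = S x
}.

End Nica.
End BaumslagSolitar.

Arguments bspa {c d}.
Arguments bspb {c d}.

(* Main.v *)
Require Import Defs.
From HB Require Import structures.
From mathcomp Require Import all_boot all_order all_algebra.
From mathcomp Require Import complex.
From mathcomp Require Import all_classical all_reals all_analysis.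
Set Implicit Arguments.
Unset Strict Implicit.
Unset Printing Implicit Defensive.
Import Order.TTheory GRing.Theory Num.Theory.
Import numFieldNormedType.Exports.
Local Open Scope ring_scope.

(** The relations hold in every Nica-covariant representation because of two
    facts on P.  If a u = b v with u, v in P then u lies in b^c P, so that
    a b^c = b^d a is the join of a and b ([a_b_meet]); compressing the
    covariance identity at this join by S_b^* and S_a gives (b).  And for
    0 < l < d the elements b^l a and a have no common upper bound
    ([bpow_a_disjoint]), so their range projections are orthogonal, which
    gives (c).

    Conversely, let U and V satisfy (a), (b) and (c).  Two things are needed.

    A multiplicative map S on P with S_a = V and S_b = U exists because P,
    although defined inside the group G, is presented as a monoid by the single
    relation a b^c = b^d a.  This is the content of the HNN normal form: every
    element of G is b^{j_1} a^{e_1} ... b^{j_k} a^{e_k} b^n with reduced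
    residues j_i and no cancellation.  The letters act on such forms by left
    multiplication, the action factors through G ([act_pres_eq]), and hence
    [nf] reads off a form from an element of G.  Elements of P have forms
    without inverse letters, and evaluating such a form in any set that carries
    two maps u, v with v u^c = u^d v turns multiplication by b and a into u and
    v ([ev_shift], [ev_push]).  Evaluation in the algebra produces S, evaluation
    in P itself shows that a form determines its element ([nfK]), and comparing
    forms yields the two facts above.

    For Nica covariance, (b) and (c) compute S_x^* S_y on generators, and such
    computations can be composed: if x p = y q is the least common multiple of
    x and y, and S_x^* S_y = S_p S_q^*, then S_x^* S_{y s} = S_p (S_q^* S_s),
    while the least common multiple of x and y s is that of q and s translated
    by y ([resolved_mulr]).  The induction closes because x and a power of b
    always have a least common multiple, of the form x b^k ([lcm_bpow]), and
    because resolving a against b^j leaves the complement b^l a with l < d, which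
    is either a itself or incompatible with a ([resolved_a]).  Every pair of elements of P
    is therefore resolved, and both cases of Nica covariance follow. *)

(** * Normal forms of an HNN extension *)

(** [Base n] is b^n, and [Push e j t] is b^j a t for [e = true] and b^j a^-1 t
    for [e = false]. *)
Inductive form := Base of int | Push of bool & int & form.

Section Forms.
Variables c d : nat.
Hypotheses (hc : (0 < c)%N) (hd : (0 < d)%N).

(** The power of b that moves past the letter [e]: b^d a = a b^c and
    b^c a^-1 = a^-1 b^d, so that b^(period e) becomes b^(period (~~ e)). *)
Definition period (e : bool) : int := if e then d%:Z else c%:Z.
Arguments period : simpl never.

Lemma period_gt0 e : 0 < period e.
Proof. by case: e. Qed.
#[local] Hint Resolve period_gt0 : core.

Lemma period_neq0 e : period e != 0.
Proof. by rewrite gt_eqF. Qed.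
#[local] Hint Resolve period_neq0 : core.

Definition headed_by (e : bool) (f : form) : bool :=
  if f is Push e' j _ then (e' == e) && (j == 0) else false.

(** Reduced forms: exponents are residues, and no letter is followed directly by
    its inverse. *)
Fixpoint valid (f : form) : bool :=
  if f is Push e j t then
    [&& 0 <= j, j < period e, ~~ headed_by (~~ e) t & valid t]
  else true.

(** Left multiplication by b^n. *)
Fixpoint shift (n : int) (f : form) : form :=
  match f with
  | Base m => Base (n + m)
  | Push e j t => Push e ((n + j) %% period e)%Z
                    (shift (((n + j) %/ period e)%Z * period (~~ e)) t)
  end.

(** Left multiplication by the letter [e], with cancellation. *)
Definition push (e : bool) (f : form) : form :=
  if headed_by (~~ e) f then (if f is Push _ _ t then t else f) else Push e 0 f.

Lemma shiftD m n f : shift m (shift n f) = shift (m + n) f.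
Proof.
elim: f m n => [k|e j t IH] m n /=; first by rewrite addrA.
(* Carry in two steps: first that of n + j, then that of m plus the residue. *)
have E : m + n + j = ((n + j) %/ period e)%Z * period e
                     + (m + ((n + j) %% period e)%Z).
  by rewrite addrCA -divz_eq addrA.
by rewrite IH E modzMDl divzMDl // -mulrDl [X in shift (X * _)]addrC.
Qed.

Lemma shift0 f : valid f -> shift 0 f = f.
Proof.
elim: f => [k _|e j t IH /= /and4P[j0 jk _ vt]] /=; first by rewrite add0r.
rewrite add0r modz_small ?j0 // divz_small ?mul0r ?IH //.
by rewrite j0 gtz0_abs.
Qed.

(** The power of b carried past a letter is a multiple of the period of the
    opposite letter, whose residue it therefore preserves: shifting a reduced
    form neither creates nor destroys a cancellation. *)
Lemma headed_shift e n f : valid f ->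
  headed_by e (shift (n * period e) f) = headed_by e f.
Proof.
case: f => //= e' j t /and4P[j0 jk _ _]; case: eqP => //= <-.
by rewrite modzMDl modz_small // j0.
Qed.

Lemma valid_shift n f : valid f -> valid (shift n f).
Proof.
elim: f n => //= e j t IH n /and4P[j0 jk ht vt].
by rewrite modz_ge0 // ltz_pmod // headed_shift // ht IH.
Qed.

Lemma valid_push e f : valid f -> valid (push e f).
Proof.
rewrite /push; case: ifP => [|h vf]; last by rewrite /= period_gt0 h.
by case: f => //= e' j t _ /and4P[].
Qed.

(** Reducedness is used when [push e] cancels: the remaining tail does not begin
    with [e], so [push (~~ e)] restores the cancelled letter. *)
Lemma pushK e f : valid f -> push (~~ e) (push e f) = f.
Proof.
rewrite {2}/push; case: ifP => [|_ _]; last by rewrite /push negbK /= !eqxx.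
case: f => //= e' j t /andP[/eqP-> /eqP->] /and4P[_ _ + _].
by rewrite /push => /negPf->.
Qed.

(** When [push] cancels a leading a^-1, the relation is used in the form
    a b^c a^-1 = b^d; otherwise b^d is carried past the new letter a as b^c. *)
Lemma push_shift f : valid f -> push true (shift c f) = shift d (push true f).
Proof.
move=> vf; have -> : c%:Z = 1 * period false by rewrite mul1r.
rewrite /push headed_shift //; case: ifP => [|_] /=.
  case: f vf => //= e j t _ /andP[/eqP-> /eqP->] /=.
  by rewrite mul1r addr0 divzz (period_neq0 false) mul1r.
by rewrite addr0 modzz divzz (period_neq0 true).
Qed.

(** * Evaluation of positive forms *)

Fixpoint pos (f : form) : bool :=
  match f with
  | Base n => 0 <= n
  | Push e j t => [&& e, 0 <= j & pos t]
  end.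

Lemma push_pos f : pos f -> push true f = Push true 0 f.
Proof. by case: f => [|[]]. Qed.

Lemma pos_push f : pos f -> pos (push true f).
Proof. by move=> pf; rewrite push_pos. Qed.

Lemma pos_shift (n : nat) f : pos f -> pos (shift n f).
Proof.
elim: f n => [k|[] j t IH] n //=; first by move=> *; rewrite addr_ge0.
case/andP=> j0 pt; rewrite modz_ge0 ?(period_neq0 true) //=.
have : 0 <= ((n%:Z + j) %/ period true)%Z by rewrite divz_ge0 // addr_ge0.
by case: divz => // q _; rewrite -PoszM IH.
Qed.

(** [M] is acted on by the monoid presented by a b^c = b^d a, with b acting as
    [u] and a as [v]; a positive form is evaluated by its action on [m0]. *)
Section Eval.
Variables (M : Type) (u v : M -> M) (m0 : M).
Hypothesis uv : forall m, v (iter c u m) = iter d u (v m).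

Fixpoint ev (f : form) : M :=
  match f with
  | Base n => iter `|n|%N u m0
  | Push _ j t => iter `|j|%N u (v (ev t))
  end.

Lemma ev_push f : pos f -> ev (push true f) = v (ev f).
Proof. by move/push_pos->. Qed.

Lemma uv_iter q m : v (iter (q * c) u m) = iter (q * d) u (v m).
Proof. by elim: q => //= q IH; rewrite !mulSn !iterD uv IH. Qed.

Lemma ev_shift (n : nat) f : pos f -> ev (shift n f) = iter n u (ev f).
Proof.
elim: f n => [[k|//]|[] // [j|//] t IH] n /=; first by rewrite iterD.
move=> pt; rewrite -PoszD modz_nat divz_nat -PoszM /= IH //.
by rewrite uv_iter -!iterD -mulnC mulnC addnC -divn_eq.
Qed.
End Eval.

(** * The action of the group on forms *)

Definition act1 (l : bsgen * bool) (f : form) : form :=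
  match l with
  | (GenA, s) => push (~~ s) f
  | (GenB, s) => shift (if s then -1 else 1) f
  end.

Definition act (w : seq (bsgen * bool)) (f : form) : form := foldr act1 f w.

Lemma valid_act w f : valid f -> valid (act w f).
Proof.
move=> vf; elim: w => //= -[[] s] w IH.
- exact: valid_push.
- exact: valid_shift.
Qed.

Lemma act_nseq n f : valid f -> act (nseq n (GenB, false)) f = shift n f.
Proof.
move=> vf; elim: n => [|n IH] /=; first by rewrite shift0.
by rewrite IH shiftD.
Qed.

Lemma act_cat u v f : act (u ++ v) f = act u (act v f).
Proof. exact: foldr_cat. Qed.

(** The action of words factors through the group: it suffices to check
    free cancellation and the defining relation, and on reduced forms only. *)
Lemma act_pres_eq u v : pres_eq (bs_rel c d) u v ->
  forall f, valid f -> act u f = act v f.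
Proof.
elim=> {u v} [//|u v _ IH|u v w _ IHu _ IHv|u u' v v' _ IHu _ IHv|x s|u v uv] f vf.
- by rewrite IH.
- by rewrite IHu ?IHv.
- by rewrite !act_cat IHv // IHu // valid_act.
- case: x => /=; first by rewrite negbK pushK.
  by rewrite shiftD -[RHS]shift0 //; congr shift; case: s.
case/andP: uv => /eqP-> /eqP->.
by rewrite -cats1 act_cat /= !act_nseq ?valid_push // push_shift.
Qed.

Definition nf (x : BS c d) : form := act (repr x) (Base 0).

Lemma nf_valid x : valid (nf x).
Proof. exact: valid_act. Qed.

Lemma nf_pi w : nf (\pi_(BS c d) w)%qT = act w (Base 0).
Proof. by apply: act_pres_eq => //; apply: pres_repr. Qed.

Lemma nf_bsa x : nf (bsa c d * x)%g = push true (nf x).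
Proof.
by elim/quotW: x => w; rewrite [(_ * _)%g]pres_mulE !nf_pi.
Qed.

Lemma nf_bsb x : nf (bsb c d * x)%g = shift 1 (nf x).
Proof.
by elim/quotW: x => w; rewrite [(_ * _)%g]pres_mulE !nf_pi.
Qed.

Lemma nf1 : nf 1%g = Base 0.
Proof. exact: nf_pi. Qed.

(** * The submonoid P *)

Local Notation P := (BSP c d).
Local Notation a := (bspa : P).
Local Notation b := (bspb : P).
Local Open Scope group_scope.

(** Left multiplication by words replaces the closure under products in the
    definition of P, which would give an induction hypothesis on both factors. *)
Lemma BSP_ind (K : P -> Prop) :
  K 1 -> (forall x, K x -> K (a * x)) -> (forall x, K x -> K (b * x)) ->
  forall x, K x.
Proof.
move=> K1 Ka Kb.
suff KM g : bs_pos g -> forall y z : P, K y -> val z = g * val y -> K z.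
  by move=> [g gP]; apply: (KM g _ 1) => //; [exact/asboolP | rewrite mulg1].
elim=> {g} [y z Ky||  |g h gP IHg hP IHh y z Ky E].
- by rewrite mul1g => /val_inj->.
- by move=> y z /Ka Kz E; rewrite (_ : z = a * y) //; apply: val_inj.
- by move=> y z /Kb Kz E; rewrite (_ : z = b * y) //; apply: val_inj.
have hyP : h * val y \in @BSpos c d.
  by apply: gpredM; [exact/asboolP | exact: valP].
by apply: (IHg (exist _ (h * val y) hyP) z); [apply: (IHh y) | rewrite E mulgA].
Qed.

Lemma BSP_mulgI (x y z : P) : x * y = x * z -> y = z.
Proof. by move/(congr1 val) => /mulgI /val_inj. Qed.

Lemma bs_pow_relation : a * b ^+ c = b ^+ d * a.
Proof.
have E n : val (b ^+ n) = (\pi_(BS c d) (nseq n (GenB, false)))%qT.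
  by elim: n => // n IH; rewrite expgS /= IH; exact: pres_mulE.
apply: val_inj; rewrite /= !E.
rewrite [LHS]pres_mulE [RHS]pres_mulE; apply/pres_piP/pres_rel.
by rewrite /bs_rel cats1 !eqxx.
Qed.

Lemma pos_nf (x : P) : pos (nf (val x)).
Proof.
elim/BSP_ind: x => [|x IH|x IH] /=; first by rewrite nf1.
- by rewrite nf_bsa pos_push.
- by rewrite nf_bsb (pos_shift 1).
Qed.

Lemma iter_bmul n (x : P) : iter n ( *%g b) x = b ^+ n * x.
Proof. by elim: n => [|n IH] /=; rewrite ?mul1g // IH expgS mulgA. Qed.

Lemma bs_iter_relation (x : P) :
  a * iter c ( *%g b) x = iter d ( *%g b) (a * x).
Proof. by rewrite !iter_bmul !mulgA bs_pow_relation. Qed.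

(** P is itself an instance of the evaluation, with b and a acting by left
    multiplication. *)
Definition BSP_of_form : form -> P := ev ( *%g b) ( *%g a) 1.

Lemma nfK (x : P) : BSP_of_form (nf (val x)) = x.
Proof.
elim/BSP_ind: x => [|x IH|x IH]; first by rewrite nf1.
- by rewrite nf_bsa /BSP_of_form ev_push ?pos_nf // -/BSP_of_form IH.
- rewrite nf_bsb /BSP_of_form (ev_shift _ bs_iter_relation 1) ?pos_nf //=.
  by rewrite -/BSP_of_form IH.
Qed.

Lemma nf_bpow n x : nf (val (b ^+ n) * x) = shift n (nf x).
Proof.
elim: n => [|n IH]; first by rewrite mul1g shift0 ?nf_valid.
by rewrite expgS /= -mulgA nf_bsb IH shiftD.
Qed.

(** The normal form of b^l a u starts with the residue l, that of a v with 0. *)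
Lemma bpow_a_disjoint l (u v : P) : (0 < l < d)%N -> b ^+ l * a * u <> a * v.
Proof.
case/andP=> l0 ld /(congr1 (nf \o val)) /=.
rewrite -mulgA nf_bpow !nf_bsa !push_pos ?pos_nf //= addr0.
rewrite modz_nat modn_small // => -[] /eqP.
by rewrite gtn_eqF.
Qed.

(** If b v begins with a, then v has a normal form b^j a t with d dividing j + 1,
    and the positive power b^(j+1) moves past a as a positive multiple of c. *)
Lemma a_b_meet (u v : P) : a * u = b * v -> exists w, u = b ^+ c * w.
Proof.
move=> E; have := congr1 (nf \o val) E; rewrite /= nf_bsa nf_bsb.
rewrite push_pos ?pos_nf //.
have := pos_nf v; case: (nf (val v)) => [//|[] // [j|//] t] /= pt [].
rewrite -PoszD modz_nat divz_nat -PoszM => -[] j0 /(congr1 BSP_of_form).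
rewrite nfK /BSP_of_form (ev_shift _ bs_iter_relation) // -/BSP_of_form iter_bmul.
have : (0 < (1 + j) %/ d)%N.
  by rewrite divn_gt0 // dvdn_leq // /dvdn -j0.
case: (_ %/ _)%N => // q _ ->.
by exists (b ^+ (q * c) * BSP_of_form t); rewrite mulSn expgnDr mulgA.
Qed.

End Forms.

(** * Isometries and the order of P *)

Section StarTheory.
Variables (R : realType) (B : cstarAlgType R).

Lemma star1 : star (1 : B) = 1.
Proof.
have := starM (1 : B) (star (1 : B)).
by rewrite mul1r starK !mul1r => <-.
Qed.

Lemma star0 : star (0 : B) = 0.
Proof. by apply: (addrI (star 0)); rewrite -starD !addr0. Qed.

Lemma starX (x : B) n : star (x ^+ n) = star x ^+ n.
Proof.
elim: n => [|n IH]; first by rewrite !expr0 star1.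
by rewrite exprS starM IH -exprSr.
Qed.

Lemma cs_isometryM (x y : B) :
  cs_isometry x -> cs_isometry y -> cs_isometry (x * y).
Proof.
move=> hx hy; rewrite /cs_isometry starM mulrA -[X in X * _]mulrA hx.
by rewrite mulr1.
Qed.

Lemma iter_mulr n (x y : B) : iter n ( *%R x) y = x ^+ n * y.
Proof. by elim: n => [|n IH] /=; rewrite ?mul1r // IH exprS mulrA. Qed.

End StarTheory.

Section Order.
Variables c d : nat.
Local Notation P := (BSP c d).
Implicit Types x y z : P.

Lemma bs_leP x y : bs_le (val x) (val y) <-> exists w, y = (x * w)%g.
Proof.
split=> [xy|[w ->]]; last by rewrite /bs_le /= mulgA mulVg mul1g; exact: valP.
exists (exist (fun g => g \in @BSpos c d) _ xy); apply: val_inj => /=.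
by rewrite mulgA mulgV mul1g.
Qed.

Lemma bs_boundP x y z : bs_upper_bound (val x) (val y) z <->
  exists u v, z = (x * u)%g /\ z = (y * v)%g.
Proof.
split=> [[/bs_leP[u zu] /bs_leP[v zv]]|[u [v [zu zv]]]]; first by exists u, v.
by split; apply/bs_leP; [exists u | exists v].
Qed.

End Order.

(** * Relations in a Nica-covariant representation *)

Section Relations.
Variables (c d : nat) (R : realType) (B : cstarAlgType R).
Local Notation P := (BSP c d).
Local Notation a := (bspa : P).
Local Notation b := (bspb : P).
Variable S : P -> B.
Hypotheses (S1 : S 1%g = 1) (SM : forall x y, S x * S y = S (x * y)%g).

Lemma mult_pow x n : S (x ^+ n)%g = S x ^+ n.
Proof.
elim: n => [|n IH]; first by rewrite expr0.
by rewrite expgS -SM IH exprS.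
Qed.

Lemma mult_relation : S a * S b ^+ c = S b ^+ d * S a.
Proof. by rewrite -!mult_pow !SM bs_pow_relation. Qed.

End Relations.

Section NicaRelations.
Variables (c d : nat) (R : realType) (B : cstarAlgType R).
Hypotheses (hc : (0 < c)%N) (hd : (0 < d)%N).
Local Notation P := (BSP c d).
Local Notation a := (bspa : P).
Local Notation b := (bspb : P).
Variable S : P -> B.
Hypothesis nS : nica_rep S.

Let S1 := nica_one nS.
Let SM := nica_mul nS.
Let SI := nica_isometry nS.

Lemma a_b_join : bs_is_join (val b) (val a) (a * b ^+ c)%g.
Proof.
split.
  apply/bs_boundP; exists (b ^+ (d - 1) * a)%g, (b ^+ c)%g; split=> //.
  by rewrite mulgA -expgS subn1 prednK // bs_pow_relation.
move=> w /bs_boundP[u [v [-> E]]].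
have [t vt] := a_b_meet hc hd (esym E).
by apply/bs_leP; exists t; rewrite E vt mulgA.
Qed.

(** Compress S_b S_b^* S_a S_a^* = S_z S_z^*, where z = a b^c, by S_b^* on the
    left and S_a on the right, and write the first S_z as S_b^d S_a. *)
Lemma nica_star_b_a : star (S b) * S a = S b ^+ (d - 1) * S a * star (S b) ^+ c.
Proof.
have := nica_join nS a_b_join; rewrite -SM mult_pow // => E.
have := congr1 (fun z => star (S b) * z * S a) E.
rewrite starM starX !mulrA SI mul1r -[LHS]mulrA SI mulr1 => ->.
rewrite -!mulrA SI mulr1 [S a * _]mulrA mult_relation //.
have -> : S b ^+ d = S b * S b ^+ (d - 1) by rewrite -exprS subn1 prednK.
by rewrite !mulrA SI mul1r.
Qed.

Lemma nica_a_bpow_a j : (1 <= j < d)%N -> star (S a) * S b ^+ j * S a = 0.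
Proof.
move=> hj; set y := (b ^+ j * a)%g.
have := @nica_orth _ _ _ _ _ nS a y.
have hyp : ~ exists z, bs_upper_bound (val a) (val y) z.
  by move=> [z /bs_boundP[u [v [-> /esym]]]]; exact: bpow_a_disjoint.
move/(_ hyp)/(congr1 (fun z => star (S a) * z * S y)).
rewrite !mulrA SI mul1r mulr0 mul0r -[LHS]mulrA SI mulr1.
by rewrite -SM mult_pow // mulrA.
Qed.

End NicaRelations.

(** * Resolving products of isometries *)

Section LeastCommonMultiples.
Variables (c d : nat) (R : realType) (B : cstarAlgType R).
Hypotheses (hc : (0 < c)%N) (hd : (0 < d)%N).
Local Notation P := (BSP c d).
Local Notation a := (bspa : P).
Local Notation b := (bspb : P).
Variable S : P -> B.
Hypotheses (S1 : S 1%g = 1) (SM : forall x y, S x * S y = S (x * y)%g).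
Hypothesis SI : forall x, cs_isometry (S x).
Hypothesis Sba : star (S b) * S a = S b ^+ (d - 1) * S a * star (S b) ^+ c.
Hypothesis Sorth : forall j, (1 <= j < d)%N -> star (S a) * S b ^+ j * S a = 0.
Implicit Types x y p q : P.

(** The least common right multiple of x and y, with complements p and q, together
    with its trace on operators. Minimality is asked of p alone: that of q follows
    by left cancellation. *)
Definition lcm_by x y p q : Prop :=
  [/\ (x * p = y * q)%g,
      forall u v, (x * u = y * v)%g -> exists w, u = (p * w)%g
    & star (S x) * S y = S p * star (S q)].

Definition clash x y : Prop :=
  (forall u v, (x * u <> y * v)%g) /\ star (S x) * S y = 0.

Definition resolved x y : Prop := (exists p q, lcm_by x y p q) \/ clash x y.

Lemma lcm_by_sym x y p q : lcm_by x y p q -> lcm_by y x q p.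
Proof.
case=> xp univ E; split=> //.
- move=> u v yu; have [w vw] := univ _ _ (esym yu); exists w.
  by apply: (@BSP_mulgI _ _ y); rewrite yu vw !mulgA xp.
- by rewrite -[LHS]starK starM starK E starM starK.
Qed.

Lemma clash_sym x y : clash x y -> clash y x.
Proof.
case=> dis E; split; first by move=> u v /esym /dis.
by rewrite -[LHS]starK starM starK E star0.
Qed.

Lemma resolved_sym x y : resolved x y -> resolved y x.
Proof.
case=> [[p [q /lcm_by_sym h]]|/clash_sym h]; last by right.
by left; exists q, p.
Qed.

Lemma lcm_by_le x y : lcm_by x (x * y)%g y 1%g.
Proof.
split; first by rewrite mulg1.
- by move=> u v; rewrite -mulgA => /BSP_mulgI ->; exists v.
- by rewrite -SM mulrA SI S1 star1 mul1r mulr1.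
Qed.

(** Join with y s in two stages: first with y, then, after cancelling y, join
    the complement q with s. *)
Lemma lcm_by_mulr x y s p q m n :
  lcm_by x y p q -> lcm_by q s m n -> lcm_by x (y * s)%g (p * m)%g n.
Proof.
case=> xp univ E [qm univ' E']; split.
- by rewrite mulgA xp -!mulgA qm.
- move=> u v xu; have [w uw] : exists w, u = (p * w)%g.
    by apply: (univ u (s * v)%g); rewrite xu mulgA.
  have [t wt] : exists t, w = (m * t)%g.
    apply: (univ' w v); apply: (@BSP_mulgI _ _ y).
    by rewrite !mulgA -xp -xu uw mulgA.
  by exists t; rewrite uw wt mulgA.
- by rewrite -!SM mulrA E -mulrA E' mulrA.
Qed.

Lemma clash_mulr x y s : clash x y -> clash x (y * s)%g.
Proof.
case=> dis E; split; first by move=> u v; rewrite -mulgA => /dis.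
by rewrite -SM mulrA E mul0r.
Qed.

Lemma lcm_by_clash x y s p q :
  lcm_by x y p q -> clash q s -> clash x (y * s)%g.
Proof.
case=> xp univ E [dis E']; split.
- move=> u v xu; have [w uw] : exists w, u = (p * w)%g.
    by apply: (univ u (s * v)%g); rewrite xu mulgA.
  apply: (dis w v); apply: (@BSP_mulgI _ _ y).
  by rewrite !mulgA -xp -xu uw mulgA.
- by rewrite -SM mulrA E -mulrA E' mulr0.
Qed.

Lemma resolved_mulr x y s p q :
  lcm_by x y p q -> resolved q s -> resolved x (y * s)%g.
Proof.
move=> xy [[m [n qs]]|qs]; last by right; apply: lcm_by_clash xy qs.
by left; exists (p * m)%g, n; apply: lcm_by_mulr xy qs.
Qed.

Lemma lcm_a_b : lcm_by a b (b ^+ c)%g (b ^+ (d - 1) * a)%g.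
Proof.
split.
- by rewrite mulgA -expgS subn1 prednK // bs_pow_relation.
- exact: a_b_meet.
- rewrite -[LHS]starK starM starK Sba starM starX starK.
  by rewrite -SM !mult_pow // !starM.
Qed.

Lemma clash_bpow_a l : (0 < l < d)%N -> clash (b ^+ l * a)%g a.
Proof.
move=> hl; split; first by move=> u v; exact: bpow_a_disjoint.
by rewrite -SM -[LHS]starK starM starK mult_pow // mulrA Sorth // star0.
Qed.

(** Absorb the letters b one at a time: the complement b^l a loses one b at each
    step, and when it has become a the next b turns it into b^(d-1) a. The bound
    l < d is what later makes b^l a either equal to a or incompatible with a. *)
Lemma lcm_a_bpow m :
  exists k l, (l < d)%N /\ lcm_by a (b ^+ m)%g (b ^+ k)%g (b ^+ l * a)%g.
Proof.
elim: m => [|m [k [l [ld IH]]]].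
  exists 0%N, 0%N; split=> //; rewrite !expg0 mul1g.
  by apply: lcm_by_sym; rewrite -{1}[a]mul1g; exact: lcm_by_le.
rewrite expgSr; case: l ld IH => [|l] ld IH.
  exists (k + c)%N, (d - 1)%N; split; first by rewrite subn1 prednK.
  rewrite mul1g in IH; rewrite expgnDr; exact: lcm_by_mulr IH lcm_a_b.
exists k, l; split; first exact: ltnW.
rewrite -[(b ^+ k)%g]mulg1; apply: lcm_by_mulr IH _.
by rewrite expgS -mulgA; apply: lcm_by_sym; exact: lcm_by_le.
Qed.

(** The multiple has the form x b^k: the power of b is pushed rightwards through
    the letters of x and stays a power of b, so the induction on x, with m
    general, goes through without meeting an incompatible pair. *)
Lemma lcm_bpow x m : exists k q, lcm_by x (b ^+ m)%g (b ^+ k)%g q.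
Proof.
elim/BSP_ind: x m => [m|x IH m|x IH [|m]].
- by exists m, 1%g; rewrite -{1}[(b ^+ m)%g]mul1g; exact: lcm_by_le.
- have [k [l [_ am]]] := lcm_a_bpow m; have [k' [q xk]] := IH k.
  exists k', (b ^+ l * a * q)%g; apply: lcm_by_sym.
  by apply: (lcm_by_mulr (lcm_by_sym am)); exact: lcm_by_sym.
- exists 0%N, (b * x)%g; rewrite !expg0; apply: lcm_by_sym.
  by rewrite -{1}[(b * x)%g]mul1g; exact: lcm_by_le.
have [k [q xm]] := IH m; exists k, q; apply: lcm_by_sym.
rewrite -[q]mul1g; apply: lcm_by_mulr (lcm_by_sym xm).
by rewrite expgS; apply: lcm_by_sym; exact: lcm_by_le.
Qed.

Lemma leading_bpow x :
  exists j, x = (b ^+ j)%g \/ exists y, x = (b ^+ j * (a * y))%g.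
Proof.
elim/BSP_ind: x => [|x _|x [j [->|[y ->]]]].
- by exists 0%N; left.
- by exists 0%N; right; exists x; rewrite mul1g.
- by exists j.+1; left; rewrite expgS.
- by exists j.+1; right; exists y; rewrite expgS !mulgA.
Qed.

(** For x = b^j a y, resolving a against b^j leaves b^l a against a y. *)
Lemma resolved_a x : resolved a x.
Proof.
have [j] := leading_bpow x.
have [k [l [ld aj]]] := lcm_a_bpow j.
case=> [->|[y ->]]; first by left; exists (b ^+ k)%g, (b ^+ l * a)%g.
apply: (resolved_mulr aj); case: l ld {aj} => [|l] ld.
  by rewrite mul1g; left; exists y, 1%g; exact: lcm_by_le.
by right; apply: clash_mulr; exact: clash_bpow_a.
Qed.

(** Induction on the letters of y, for all x at once: when x has been resolved
    against the first letter, an arbitrary complement q takes its place. *)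
Lemma resolved_all x y : resolved x y.
Proof.
elim/BSP_ind: y x => [x|y IH x|y IH x].
- left; exists 1%g, x; apply: lcm_by_sym.
  by rewrite -{1}[x]mul1g; exact: lcm_by_le.
- have [[p [q ax]]|ax] := resolved_sym (resolved_a x).
    exact: resolved_mulr ax (IH q).
  by right; exact: clash_mulr.
have [k [q bx]] := lcm_bpow x 1.
exact: resolved_mulr bx (IH q).
Qed.

(** A right invertible isometry is unitary, so two least common multiples, which
    differ by an invertible element of P, have the same range projection. *)
Lemma range_proj_unit x w t : (w * t)%g = 1%g ->
  S (x * w)%g * star (S (x * w)%g) = S x * star (S x).
Proof.
move=> wt; have Sw : star (S w) = S t.
  by rewrite -[LHS]mulr1 -S1 -wt -SM mulrA SI mul1r.
by rewrite -SM starM Sw -mulrA [S w * _]mulrA SM wt S1 mul1r.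
Qed.

Lemma nica_rep_of_relations : nica_rep S.
Proof.
have projM x y : S x * star (S x) * (S y * star (S y))
    = S x * (star (S x) * S y) * star (S y) by rewrite !mulrA.
split=> // x y => [z|] hz; rewrite projM.
  case: hz => /bs_boundP[u [v [zu zv]]] least.
  have [[p [q [xp univ ->]]]|[dis _]] := resolved_all x y; last first.
    by case: (dis u v); rewrite -zu.
  (* z and x p are least common multiples, hence differ by a unit w. *)
  have [w uw] : exists w, u = (p * w)%g by apply: (univ u v); rewrite -zu.
  have /bs_leP[t zt] : bs_le (val z) (val (x * p)%g).
    by apply: least; apply/bs_boundP; exists p, q.
  have wt : (w * t)%g = 1%g.
    apply: (@BSP_mulgI _ _ (x * p)%g).
    by rewrite mulg1 [RHS]zt zu uw !mulgA.
  rewrite zu uw mulgA (range_proj_unit _ wt) mulrA SM -mulrA -starM SM.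
  by rewrite -xp.
have [[p [q [xp _ _]]]|[_ ->]] := resolved_all x y; last by rewrite mulr0 mul0r.
by case: hz; exists (x * p)%g; apply/bs_boundP; exists p, q.
Qed.

End LeastCommonMultiples.

(** * The representation defined by U and V *)

Section Construction.
Variables (c d : nat) (R : realType) (B : cstarAlgType R).
Hypotheses (hc : (0 < c)%N) (hd : (0 < d)%N).
Local Notation P := (BSP c d).
Local Notation a := (bspa : P).
Local Notation b := (bspb : P).
Variables U V : B.
Hypothesis VU : V * U ^+ c = U ^+ d * V.

Definition rep_of (x : P) : B := ev ( *%R U) ( *%R V) 1 (nf (val x)).

Lemma rep_of1 : rep_of 1%g = 1.
Proof. by rewrite /rep_of nf1. Qed.

Lemma rep_of_aM x : rep_of (a * x)%g = V * rep_of x.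
Proof. by rewrite /rep_of nf_bsa // ev_push ?pos_nf. Qed.

Lemma rep_of_bM x : rep_of (b * x)%g = U * rep_of x.
Proof.
have rel m : V * iter c ( *%R U) m = iter d ( *%R U) (V * m).
  by rewrite !iter_mulr !mulrA VU.
by rewrite /rep_of nf_bsb // (ev_shift _ rel 1) ?pos_nf.
Qed.

Lemma rep_ofM x y : rep_of x * rep_of y = rep_of (x * y)%g.
Proof.
elim/BSP_ind: x => [|x IH|x IH]; first by rewrite rep_of1 mul1r mul1g.
- by rewrite -mulgA !rep_of_aM -mulrA IH.
- by rewrite -mulgA !rep_of_bM -mulrA IH.
Qed.

Lemma rep_of_a : rep_of a = V.
Proof. by rewrite -[a]mulg1 rep_of_aM rep_of1 mulr1. Qed.

Lemma rep_of_b : rep_of b = U.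
Proof. by rewrite -[b]mulg1 rep_of_bM rep_of1 mulr1. Qed.

Lemma rep_of_isometry : cs_isometry U -> cs_isometry V ->
  forall x, cs_isometry (rep_of x).
Proof.
move=> hU hV; elim/BSP_ind=> [|x IH|x IH].
- by rewrite /cs_isometry rep_of1 star1 mul1r.
- by rewrite rep_of_aM; exact: cs_isometryM.
- by rewrite rep_of_bM; exact: cs_isometryM.
Qed.

End Construction.

Lemma nica_rep_comp (R : realType) (c d : nat) (A B : cstarAlgType R)
    (T : BSP c d -> A) (pi : A -> B) :
  nica_rep T -> star_hom pi -> pi 1 = 1 -> nica_rep (pi \o T).
Proof.
move=> [TI T1 TM TJ TO] [plin pM pS] p1.
have p0 : pi 0 = 0.
  by have := plin (-1) 0 0; rewrite !scaleN1r oppr0 addr0 addNr.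
split=> /= [x||x y|x y z hz|x y hxy].
- by rewrite /cs_isometry -pS -pM TI.
- by rewrite T1.
- by rewrite -pM TM.
- by rewrite -!pS -!pM (TJ _ _ _ hz).
- by rewrite -!pS -!pM (TO _ _ hxy).
Qed.

(** * The theorem *)

Theorem proposition4p1 (R : realType) (c d : nat)
    (hc : (0 < c)%N) (hd : (0 < d)%N) :
  (forall (A : cstarAlgType R) (T : BSP c d -> A), universal_nica T ->
    forall (B : cstarAlgType R) (pi : A -> B), star_hom pi -> pi 1 = 1 ->
    let U := pi (T bspb) in
    let V := pi (T bspa) in
    [/\ cs_isometry U, cs_isometry V,
        V * U ^+ c = U ^+ d * V,
        star U * V = U ^+ (d - 1) * V * star U ^+ c
      & forall j : nat, (1 <= j < d)%N -> star V * U ^+ j * V = 0])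
  /\
  (forall (B : cstarAlgType R) (U V : B),
    cs_isometry U -> cs_isometry V ->
    V * U ^+ c = U ^+ d * V ->
    star U * V = U ^+ (d - 1) * V * star U ^+ c ->
    (forall j : nat, (1 <= j < d)%N -> star V * U ^+ j * V = 0) ->
    (exists S : BSP c d -> B,
      [/\ nica_rep S, S bspa = V & S bspb = U]) /\
    (forall (A : cstarAlgType R) (T : BSP c d -> A), universal_nica T ->
      exists pi : A -> B,
        [/\ star_hom pi, U = pi (T bspb) & V = pi (T bspa)])).
Proof.
split=> [A T uT B pi hpi p1 U V|B U V hU hV VU UV VUV].
  have nS := nica_rep_comp (universal_nica_rep uT) hpi p1.
  split.
  - exact: (nica_isometry nS bspb).
  - exact: (nica_isometry nS bspa).
  - exact: (mult_relation (nica_one nS) (nica_mul nS)).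
  - exact: (nica_star_b_a hc hd nS).
  - exact: (nica_a_bpow_a hc hd nS).
have nS : nica_rep (rep_of U V : BSP c d -> B).
  apply: (nica_rep_of_relations hc hd).
  - exact: rep_of1.
  - exact: rep_ofM.
  - exact: rep_of_isometry.
  - by rewrite rep_of_a // rep_of_b.
  - by rewrite rep_of_a // rep_of_b.
split; first by exists (rep_of U V); rewrite rep_of_a // rep_of_b.
move=> A T uT; have [pi [hpi piT]] := universal_nica_lift uT nS.
by exists pi; rewrite !piT rep_of_a // rep_of_b.
Qed.
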